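(* Let $C\subset N$ and let $\beta$ be a nonnegative integer with $\beta<|C|$ such that $\sum_{j\in C}x_j\leq\beta$ is valid for the knapsack polytope. Regard this inequality as the knapsack inequality $\sum_{j\in N}\alpha_jx_j\leq\beta$ with $\alpha_j=1$ for $j\in C$ and $\alpha_j=0$ for $j\in N\setminus C$, and form its SKILS, with the right-hand side strengthening described in the context applied whenever it is applicable. (i) If $|C|$ is even, then SCILS is a particular case of SKILS: up to multiplication by $2$, the inequalities in the SCILS derived from $\sum_{j\in C}x_j\leq\beta$ are exactly the inequalities in the SKILS corresponding to it. (ii) If $|C|$ is odd, then the inequalities in SCILS are stronger than those in SKILS: for every $i_0\in C$ and every partition $P$ of $C\setminus\{i_0\}$ into pairs, every $X\in\mathbb{S}^n$ with all entries in $[0,1]$ that satisfies the SCILS inequality given by $(i_0,P)$ also satisfies the SKILS inequality given by $(i_0,P)$, while the converse implication does not hold.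
   Context: Let $N=\{1,\ldots,n\}$, let $w\in\mathbb{Z}^n$ have positive entries, and let $c$ be a positive integer with $c\geq w_i$ for all $i\in N$. The knapsack polytope is the convex hull of $\{x\in\{0,1\}^n : w^Tx\leq c\}$. $\mathbb{S}^n$ is the set of real symmetric $n\times n$ matrices; the variable $X\in\mathbb{S}^n$ represents $xx^T$. Partitions of a set into pairs are written as sets of pairs $(i,j)$ with $i<j$. SCILS. For $C,\beta$ as in the claim, the set of cover inequalities in the lifted space (SCILS) derived from $\sum_{j\in C}x_j\leq\beta$ consists of all inequalities $\sum_{(i,j)\in C_s}X_{ij}\leq\lfloor\beta/2\rfloor$, where: if $|C|$ is even, $C_s$ is any partition of $C$ into pairs; if $|C|$ and $\beta$ are odd, $C_s=P$ with $P$ any partition of $C\setminus\{i_0\}$ into pairs and $i_0$ any element of $C$; if $|C|$ is odd and $\beta$ is even, $C_s=\{(i_0,i_0)\}\cup P$ with $P$ any partition of $C\setminus\{i_0\}$ into pairs and $i_0$ any element of $C$. SKILS. For a valid inequality $\sum_{j\in N}\alpha_jx_j\leq\beta$ with $\alpha_j,\beta$ nonnegative integers and $\beta\geq\alpha_j$ for all $j$, let $\{C_1,\ldots,C_q\}$ be the partition of $N$ into classes of equal coefficient ($\alpha_u=\alpha_v$ if and only if $u,v$ are in the same class), and let $\tilde\alpha_k$ be the common coefficient on $C_k$. For each $k$ let $C_{l_k}$ be a partition into pairs of $C_k$ if $|C_k|$ is even, and of $C_k\setminus\{i_{k_0}\}$ for some $i_{k_0}\in C_k$ if $|C_k|$ is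 odd. The set of knapsack inequalities in the lifted space (SKILS) consists of all inequalities $$\sum_{k=1}^q\Big(\tilde\alpha_kX_{i_{k_0}i_{k_0}}+2\tilde\alpha_k\sum_{(i,j)\in C_{l_k}}X_{ij}\Big)\leq\beta$$ over all such choices, the term $\tilde\alpha_kX_{i_{k_0}i_{k_0}}$ being absent when $|C_k|$ is even. Strengthening: if $\tilde\alpha_k$ is even for every $k$ such that $|C_k|$ is odd, the right-hand side $\beta$ is replaced with $2\lfloor\beta/2\rfloor$. For the coefficients in the claim, the class with coefficient $0$ contributes nothing; when $|C|$ is odd the SKILS inequality given by $(i_0,P)$ is the one with $i_{k_0}=i_0$ and $C_{l_k}=P$ for the class $C_k=C$, and the SCILS inequality given by $(i_0,P)$ is the one with $C_s=P$ ($\beta$ odd) or $C_s=\{(i_0,i_0)\}\cup P$ ($\beta$ even). *)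

(* Defs.v *)
From mathcomp Require Export all_boot all_order all_algebra.
From mathcomp Require Export classical_sets reals convex.
Export Order.TTheory GRing.Theory Num.Theory.

Set Implicit Arguments.
Unset Strict Implicit.
Unset Printing Implicit Defensive.

Local Open Scope ring_scope.

Definition knapsack_polytope (R : realType) (n : nat) (w : 'cV[int]_n) (c : int)
    : set 'cV[R]_n :=
  smallest (@convex_set R 'cV[R]_n)
    [set x | (forall i, x i 0 = 0 \/ x i 0 = 1) /\
             \sum_i (w i 0)%:~R * x i 0 <= c%:~R]%classic.

(* The inequality \sum_(i, j) A i j * X i j <= b on 'M[R]_n.  Below, A is always
   supported on the entries i <= j, so that distinct pairs (A, b) are distinct
   inequalities in the variables X i j, i <= j, of a symmetric matrix. *)
Record lifted_ineq (R : realType) (n : nat) := LiftedIneq {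
  lhs_coef : 'M[R]_n;
  rhs_coef : R
}.

Definition satisfies (R : realType) (n : nat) (X : 'M[R]_n)
    (I : lifted_ineq R n) : Prop :=
  \sum_i \sum_j lhs_coef I i j * X i j <= rhs_coef I.

Definition scale_ineq (R : realType) (n : nat) (a : R) (I : lifted_ineq R n) :=
  LiftedIneq (a *: lhs_coef I) (a * rhs_coef I).

Definition unit_interval_sym (R : realType) (n : nat) (X : 'M[R]_n) : Prop :=
  X^T = X /\ (forall i j, 0 <= X i j <= 1).

Definition pair_partition (n : nat) (P : {set 'I_n * 'I_n}) (D : {set 'I_n}) :=
  [forall p in P, (p.1 < p.2)%N] &&
  finset.partition [set [set p.1; p.2] | p in P] D.

(* The choice, for an index set D, of a partition into pairs: of D itself if #|D|
   is even (o = None), and of D minus some i0 \in D if #|D| is odd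
   (o = Some i0). *)
Definition pairing (n : nat) (D : {set 'I_n}) (o : option 'I_n)
    (P : {set 'I_n * 'I_n}) : bool :=
  if o is Some i0 then [&& odd #|D|, i0 \in D & pair_partition P (D :\ i0)]
  else ~~ odd #|D| && pair_partition P D.

Definition scils_pairs (n : nat) (beta : nat) (o : option 'I_n)
    (P : {set 'I_n * 'I_n}) : {set 'I_n * 'I_n} :=
  if o is Some i0 then if odd beta then P else (i0, i0) |: P else P.

Definition scils_ineq (R : realType) (n : nat) (beta : nat) (o : option 'I_n)
    (P : {set 'I_n * 'I_n}) : lifted_ineq R n :=
  LiftedIneq (\sum_(p in scils_pairs beta o P) delta_mx p.1 p.2) (beta./2)%:R.

Definition scils (R : realType) (n : nat) (C : {set 'I_n}) (beta : nat)
    (I : lifted_ineq R n) : Prop :=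
  exists o P, pairing C o P /\ I = scils_ineq R beta o P.

Definition coef_classes (n : nat) (alpha : 'I_n -> nat) : {set {set 'I_n}} :=
  preim_partition alpha [set: 'I_n].

(* The value of alpha on D, when D is nonempty and alpha is constant on D. *)
Definition common_coef (n : nat) (alpha : 'I_n -> nat) (D : {set 'I_n}) : nat :=
  if [pick j in D] is Some j then alpha j else 0%N.

Definition skils_rhs (n : nat) (alpha : 'I_n -> nat) (beta : nat) : nat :=
  if [forall D in coef_classes alpha,
        odd #|D| ==> ~~ odd (common_coef alpha D)]
  then (2 * beta./2)%N else beta.

Definition skils_ineq (R : realType) (n : nat) (alpha : 'I_n -> nat)
    (beta : nat) (o : {set 'I_n} -> option 'I_n)
    (P : {set 'I_n} -> {set 'I_n * 'I_n}) : lifted_ineq R n :=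
  LiftedIneq
    (\sum_(D in coef_classes alpha)
       ((if o D is Some i0 then (common_coef alpha D)%:R *: delta_mx i0 i0
         else 0) +
        (2 * common_coef alpha D)%:R *: \sum_(p in P D) delta_mx p.1 p.2))
    (skils_rhs alpha beta)%:R.

Definition skils_choice (n : nat) (alpha : 'I_n -> nat)
    (o : {set 'I_n} -> option 'I_n) (P : {set 'I_n} -> {set 'I_n * 'I_n}) :=
  [forall D in coef_classes alpha, pairing D (o D) (P D)].

Definition skils (R : realType) (n : nat) (alpha : 'I_n -> nat) (beta : nat)
    (I : lifted_ineq R n) : Prop :=
  exists o P, skils_choice alpha o P /\ I = skils_ineq R alpha beta o P.

Definition cover_coef (n : nat) (C : {set 'I_n}) (j : 'I_n) : nat := j \in C.

(* I is a member of the SKILS of \sum_(j in C) x j <= beta whose choice on the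
   class C is (i0, P); the choice on the class of coefficient 0 is free. *)
Definition skils_given (R : realType) (n : nat) (C : {set 'I_n}) (beta : nat)
    (i0 : 'I_n) (P : {set 'I_n * 'I_n}) (I : lifted_ineq R n) : Prop :=
  exists o Q, [/\ skils_choice (cover_coef C) o Q, o C = Some i0, Q C = P
                & I = skils_ineq R (cover_coef C) beta o Q].

(* Main.v *)
From HB Require Import structures.
From mathcomp Require Import lra zify.
Require Import Defs.

Set Implicit Arguments.
Unset Strict Implicit.
Unset Printing Implicit Defensive.

Local Open Scope ring_scope.

(** The inequality has at most two coefficient classes, [C] with coefficient [1]
    and its complement with coefficient [0]. The complement contributes nothing,
    and it always admits a pairing, so every choice on [C] extends to a SKILS
    choice and determines its inequality: [skils_choice_extend] and
    [skils_ineq_cover].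

    If [#|C|] is even, no class of odd size has an odd coefficient, so the bound
    of SKILS is strengthened to [2 * floor (beta / 2)], and the SKILS inequality
    is twice the SCILS one for the same partition of [C].

    If [#|C|] is odd, the class [C] blocks the strengthening. Write [x] for
    [X i0 i0] and [s] for the sum of [X] over the pairs: SKILS reads
    [x + 2 s <= beta], while SCILS reads [2 s <= beta - 1] for odd [beta] and
    [2 x + 2 s <= beta] for even [beta]. The bounds [x <= 1] and [0 <= x]
    respectively turn the second into the first ([scils_imp_skils]).
    Conversely, a matrix with the opposite extreme value of [x] ([0] for odd
    [beta], [1] for even [beta]) and equal off-diagonal entries making SKILS
    tight violates SCILS ([skils_tight_not_scils]). Its entries lie in [[0, 1]]
    because [1 <= beta <= #|C| - 1]. At [beta = 0] both inequalities would force
    all the entries involved to vanish, so the strictness rests on [0 < beta]: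
    each unit vector is feasible since [w_i <= c], hence a valid inequality on
    the nonempty [C] has a positive right-hand side ([valid_cover_rhs_gt0]). *)

(** * Partitions into pairs *)

Lemma pair_partition_lt (n : nat) (P : {set 'I_n * 'I_n}) (D : {set 'I_n}) p :
  pair_partition P D -> p \in P -> (p.1 < p.2)%N.
Proof. by case/andP=> /forallP /(_ p) /implyP. Qed.

Lemma ordered_pair_set_inj (n : nat) (p q : 'I_n * 'I_n) :
  (p.1 < p.2)%N -> (q.1 < q.2)%N -> [set p.1; p.2] = [set q.1; q.2] -> p = q.
Proof.
case: p q => [p1 p2] [q1 q2] /= ltp ltq e.
have /set2P[e1|e1] : p1 \in [set q1; q2] by rewrite -e !inE eqxx.
  have /set2P[e2|e2] : p2 \in [set q1; q2] by rewrite -e !inE eqxx orbT.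
    by move: ltp; rewrite e1 e2 ltnn.
  by rewrite e1 e2.
have /set2P[e2|e2] : p2 \in [set q1; q2] by rewrite -e !inE eqxx orbT.
  by move: ltp; rewrite e1 e2 ltnNge (ltnW ltq).
by move: ltp; rewrite e1 e2 ltnn.
Qed.

(** Ordering the two members of each pair makes the passage from pairs to
    two-element blocks injective, so the blocks can be counted by [P]. *)
Lemma card_pair_partition (n : nat) (P : {set 'I_n * 'I_n}) (D : {set 'I_n}) :
  pair_partition P D -> #|D| = (#|P|.*2)%N.
Proof.
move=> pP; have ltP := pair_partition_lt pP.
case/andP: pP => _ /(@card_uniform_partition _ 2) ->.
  rewrite card_in_imset ?muln2 // => p q /ltP ltp /ltP ltq.
  exact: ordered_pair_set_inj.
by move=> A /imsetP[p /ltP ltp ->]; rewrite cards2 -val_eqE neq_ltn ltp.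
Qed.

Lemma pair_partition_exists (n : nat) (D : {set 'I_n}) :
  ~~ odd #|D| -> exists P, pair_partition P D.
Proof.
move: {2}#|D| (leqnn #|D|) => m; elim: m D => [|m IHm] D leDm evD.
  exists finset.set0; apply/andP; split.
    by apply/forallP=> p; rewrite inE.
  move: leDm; rewrite leqn0 cards_eq0 => /eqP ->.
  by rewrite imset0 partition_set0.
have [D0|[a aD]] := set_0Vmem D.
  by apply: IHm evD; rewrite D0 cards0.
have [Da0|[b bDa]] := set_0Vmem (D :\ a).
  by move: evD; rewrite (cardsD1 a D) aD Da0 cards0.
wlog ltab : a b aD bDa / (a < b)%N.
  move=> wlab; case: (ltngtP a b) => [ltab|ltba|eab].
  - exact: (wlab a b).
  - move: bDa; rewrite !inE => /andP[nba bD].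
    by apply: (wlab b a) => //; rewrite !inE eq_sym nba.
  - by move: bDa; rewrite (val_inj eab) !inE eqxx.
have cD : #|D| = #|D :\ a :\ b|.+2.
  by rewrite (cardsD1 a) aD (cardsD1 b) bDa.
have [||P /andP[/forallP ltP partP]] := IHm (D :\ a :\ b).
- by move: leDm; rewrite cD; lia.
- by move: evD; rewrite cD /= negbK.
exists ((a, b) |: P); apply/andP; split.
  apply/forallP=> p; apply/implyP => /setU1P[-> //|pP].
  by move: (ltP p); rewrite pP.
rewrite imsetU1 /=.
have -> : D = [set a; b] :|: (D :\ a :\ b).
  apply/setP=> x; move: bDa; rewrite !inE => /andP[_ bD].
  by case: eqP => [->|_]; case: eqP => [->|_].
apply: partitionU1 => //.
  by apply/set0Pn; exists a; rewrite !inE eqxx.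
rewrite -setI_eq0; apply/eqP/setP=> x; rewrite !inE.
by case: (x == a); case: (x == b).
Qed.

Lemma pairing_exists (n : nat) (D : {set 'I_n}) : exists o P, pairing D o P.
Proof.
have [odD|evD] := boolP (odd #|D|); last first.
  have [P pP] := pair_partition_exists evD.
  by exists None, P; rewrite /= evD.
have [D0|[i iD]] := set_0Vmem D; first by rewrite D0 cards0 in odD.
have [|P pP] := @pair_partition_exists _ (D :\ i).
  by move: odD; rewrite (cardsD1 i D) iD.
by exists (Some i), P; rewrite /= odD iD.
Qed.

(** * The SKILS of a cover inequality *)

Lemma cover_class_eq (n : nat) (C D : {set 'I_n}) :
  D \in coef_classes (cover_coef C) -> D = C \/ D = ~: C.
Proof.
case/imsetP=> x _ ->; rewrite /cover_coef.
case: (boolP (x \in C)) => xC; [left | right]; apply/setP=> y;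
  by rewrite !inE; case: (y \in C).
Qed.

Lemma cover_class_mem (n : nat) (C : {set 'I_n}) (i : 'I_n) :
  i \in C -> C \in coef_classes (cover_coef C).
Proof.
move=> iC; apply/imsetP; exists i => //; apply/setP=> y.
by rewrite !inE /cover_coef iC; case: (y \in C).
Qed.

Lemma common_coef_cover (n : nat) (C : {set 'I_n}) (i : 'I_n) :
  i \in C -> common_coef (cover_coef C) C = 1%N.
Proof.
move=> iC; rewrite /common_coef; case: pickP => [j jC|/(_ i)].
  by rewrite /cover_coef jC.
by rewrite iC.
Qed.

Lemma common_coef_cover0 (n : nat) (C : {set 'I_n}) :
  common_coef (cover_coef C) (~: C) = 0%N.
Proof.
rewrite /common_coef; case: pickP => // j; rewrite inE => /negbTE jC.
by rewrite /cover_coef jC.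
Qed.

(** Only the class [C] can block the strengthening: its coefficient [1]
    is odd; the coefficient [0] of the other class is always even. *)
Lemma skils_rhs_cover (n : nat) (C : {set 'I_n}) (beta : nat) (i : 'I_n) :
  i \in C ->
  skils_rhs (cover_coef C) beta = if odd #|C| then beta else (2 * beta./2)%N.
Proof.
move=> iC; rewrite /skils_rhs; case: ifP => [/forallP/(_ C)|/negP ncl].
  by rewrite (cover_class_mem iC) (common_coef_cover iC) /= implybF => /negbTE->.
case: ifP => // /negbT evC; case: ncl; apply/forallP=> D; apply/implyP.
case/cover_class_eq=> ->; first by rewrite (negbTE evC).
by rewrite common_coef_cover0 implybT.
Qed.

(** Of the at most two coefficient classes, only [C] has a nonzero coefficient,
    so the choice made on its complement leaves no trace in the inequality. *)
Lemma skils_ineq_cover (R : realType) (n : nat) (C : {set 'I_n}) (beta : nat)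
    (i : 'I_n) o P : i \in C ->
  skils_ineq R (cover_coef C) beta o P =
  LiftedIneq
    ((if o C is Some i0 then delta_mx i0 i0 else 0) +
     2 *: \sum_(p in P C) delta_mx p.1 p.2)
    (if odd #|C| then beta else (2 * beta./2)%N)%:R.
Proof.
move=> iC; rewrite /skils_ineq (skils_rhs_cover _ iC); congr LiftedIneq.
rewrite (bigD1 C) ?(cover_class_mem iC) //= [X in _ + X = _]big1 ?addr0 => [|D].
  by rewrite (common_coef_cover iC) muln1; case: (o C) => [j|]; rewrite ?scale1r.
case/andP=> /cover_class_eq[->|->]; first by rewrite eqxx.
rewrite common_coef_cover0 muln0 scale0r addr0.
by case: (o _) => // j; rewrite scale0r.
Qed.

(** What makes the SKILS inequality given by a choice on [C] exist: the
    complement of [C] must also be paired, in an arbitrary way. *)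
Lemma skils_choice_extend (n : nat) (C : {set 'I_n}) o P : pairing C o P ->
  exists o' P', [/\ skils_choice (cover_coef C) o' P', o' C = o & P' C = P].
Proof.
move=> pC; have [o1 [P1 p1]] := pairing_exists (~: C).
exists (fun D => if D == C then o else o1), (fun D => if D == C then P else P1).
rewrite !eqxx; split=> //; apply/forallP=> D; apply/implyP.
case: eqP => [-> //|neDC].
by case/cover_class_eq => [/neDC|->].
Qed.

(** * Evaluating lifted inequalities *)

(** The entrywise inner product: the left-hand side of a lifted inequality, as a
    linear form in its coefficient matrix. *)
Definition mxdot (R : realType) (n : nat) (X A : 'M[R]_n) : R :=
  \sum_i \sum_j A i j * X i j.

Lemma mxdot_is_linear (R : realType) (n : nat) (X : 'M[R]_n) :
  scalar (mxdot X).
Proof.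
move=> a A B; rewrite /mxdot mulr_sumr -big_split; apply: eq_bigr => i _ /=.
rewrite mulr_sumr -big_split; apply: eq_bigr => j _ /=.
by rewrite !mxE mulrDl mulrA.
Qed.

HB.instance Definition _ (R : realType) (n : nat) (X : 'M[R]_n) :=
  GRing.isLinear.Build R 'M[R]_n R _ (mxdot X) (mxdot_is_linear X).

Lemma mxdot_delta (R : realType) (n : nat) (X : 'M[R]_n) i j :
  mxdot X (delta_mx i j) = X i j.
Proof.
rewrite /mxdot (bigD1 i) //= [X in _ + X]big1 ?addr0 => [|k nki].
  rewrite (bigD1 j) //= big1 ?addr0 ?mxE ?eqxx ?mul1r // => k nkj.
  by rewrite mxE (negbTE nkj) andbF mul0r.
by apply: big1 => l _; rewrite mxE (negbTE nki) mul0r.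
Qed.

Lemma mxdot_pairs (R : realType) (n : nat) (X : 'M[R]_n) (P : {set 'I_n * 'I_n}) :
  mxdot X (\sum_(p in P) delta_mx p.1 p.2) = \sum_(p in P) X p.1 p.2.
Proof. by rewrite linear_sum; apply: eq_bigr => p _ /=; rewrite mxdot_delta. Qed.

Lemma satisfies_scils_Some (R : realType) (n : nat) (X : 'M[R]_n) (beta : nat)
    (i0 : 'I_n) (P : {set 'I_n * 'I_n}) (D : {set 'I_n}) : pair_partition P D ->
  satisfies X (scils_ineq R beta (Some i0) P) =
  ((~~ odd beta)%:R * X i0 i0 + \sum_(p in P) X p.1 p.2 <= (beta./2)%:R).
Proof.
move=> pP; rewrite /satisfies -/(mxdot _ _) /= mxdot_pairs.
case: (odd beta) => /=; first by rewrite mul0r add0r.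
rewrite big_setU1 /= ?mul1r //.
by apply/negP => /(pair_partition_lt pP); rewrite ltnn.
Qed.

(** * The knapsack polytope *)

Lemma unit_vector_in_knapsack (R : realType) (n : nat) (w : 'cV[int]_n)
    (c : int) (i : 'I_n) :
  w i 0 <= c -> knapsack_polytope w c (delta_mx i 0 : 'cV[R]_n).
Proof.
move=> wic; apply: sub_gen_smallest; split=> [j|].
  by rewrite mxE eqxx andbT; case: eqP; [right | left].
rewrite (bigD1 i) //= big1 ?addr0 => [|j nji].
  by rewrite mxE !eqxx mulr1 ler_int.
by rewrite mxE (negbTE nji) mulr0.
Qed.

(** A unit vector supported in [C] is feasible and has left-hand side [1]. *)
Lemma valid_cover_rhs_gt0 (R : realType) (n : nat) (w : 'cV[int]_n) (c : int)
    (C : {set 'I_n}) (beta : nat) (i : 'I_n) :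
  w i 0 <= c -> i \in C ->
  (forall x : 'cV[R]_n, knapsack_polytope w c x ->
     \sum_(j in C) x j 0 <= beta%:R) ->
  (0 < beta)%N.
Proof.
move=> wic iC /(_ _ (unit_vector_in_knapsack (R := R) wic)).
rewrite (bigD1 i) //= big1 ?addr0 => [|j /andP[_ nji]].
  by rewrite mxE !eqxx (ler_nat R 1).
by rewrite mxE (negbTE nji).
Qed.

(** * Comparison for covers of odd size *)

Lemma natr_half (R : realType) (m : nat) :
  m%:R = (odd m)%:R + 2 * (m./2)%:R :> R.
Proof. by rewrite -natrM -natrD mul2n odd_double_half. Qed.

(** Twice the SCILS inequality, plus [x <= 1] for odd [beta] or [- x <= 0] for
    even [beta]; for odd [beta] the added [1] is what the floor has removed. *)
Lemma scils_imp_skils (R : realType) (beta : nat) (x s : R) :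
  0 <= x <= 1 -> (~~ odd beta)%:R * x + s <= (beta./2)%:R ->
  x + 2 * s <= beta%:R.
Proof.
rewrite (natr_half R beta) => /andP[x0 x1].
by case: (odd beta) => /=; lra.
Qed.

Definition two_valued_mx (R : realType) (n : nat) (a b : R) : 'M[R]_n :=
  \matrix_(i, j) if i == j then a else b.

Lemma two_valued_mx_unit (R : realType) (n : nat) (a b : R) :
  0 <= a <= 1 -> 0 <= b <= 1 -> unit_interval_sym (two_valued_mx n a b).
Proof.
move=> ha hb; split=> [|i j]; last by rewrite mxE; case: ifP.
by apply/matrixP=> i j; rewrite !mxE eq_sym.
Qed.

Lemma two_valued_mx_pairs (R : realType) (n : nat) (a b : R)
    (P : {set 'I_n * 'I_n}) (D : {set 'I_n}) : pair_partition P D ->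
  \sum_(p in P) two_valued_mx n a b p.1 p.2 = #|P|%:R * b.
Proof.
move=> pP; rewrite mulr_natl -sumr_const; apply: eq_bigr => p pP'.
by rewrite mxE -val_eqE ltn_eqF // (pair_partition_lt pP pP').
Qed.

(** With [a = 0] for odd [beta] and [a = 1] for even [beta], and all pair
    entries equal, the SKILS inequality is made tight; the SCILS left-hand side
    is then [beta / 2], resp. [(beta + 1) / 2], above its floored bound.
    The pair entries are nonnegative because [a <= 1 <= beta], and at most [1]
    because [beta] is at most twice the number of pairs. *)
Lemma skils_tight_not_scils (R : realType) (n beta : nat) (i0 : 'I_n)
    (P : {set 'I_n * 'I_n}) (D : {set 'I_n}) :
  pair_partition P D -> (0 < beta <= #|D|)%N ->
  exists X : 'M[R]_n, [/\ unit_interval_sym X,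
    X i0 i0 + 2 * \sum_(p in P) X p.1 p.2 <= beta%:R &
    ~ satisfies X (scils_ineq R beta (Some i0) P)].
Proof.
move=> pP; rewrite (card_pair_partition pP) => /andP[beta_gt0 beta_le].
have P_gt0 : 0 < #|P|%:R :> R by rewrite ltr0n; lia.
have le_beta : beta%:R <= 2 * #|P|%:R :> R by rewrite -natrM ler_nat mul2n.
have ge_beta : 1 <= beta%:R :> R by rewrite ler1n.
(* The pairs share what the diagonal entry leaves of [beta]. *)
pose a : R := (~~ odd beta)%:R.
have a01 : 0 <= a <= 1 by rewrite /a; case: (odd beta) => /=; rewrite ?lexx ler01.
pose b : R := (beta%:R - a) / (2 * #|P|%:R).
have Pb : 2 * (#|P|%:R * b) = beta%:R - a.
  by rewrite mulrA mulrC divfK // gt_eqF // mulr_gt0.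
have b01 : 0 <= b <= 1.
  case/andP: a01 => a0 a1; apply/andP; split.
    by rewrite divr_ge0 ?subr_ge0 //; lra.
  by rewrite ler_pdivrMr ?mul1r; lra.
exists (two_valued_mx n a b); split; first exact: two_valued_mx_unit.
  by rewrite (two_valued_mx_pairs _ _ pP) Pb mxE eqxx; lra.
rewrite (satisfies_scils_Some _ _ _ pP) (two_valued_mx_pairs _ _ pP) mxE eqxx.
move: Pb; rewrite (natr_half R beta) /a; case: (odd beta) => /= Pb; apply/negP;
  rewrite -ltNge; lra.
Qed.

Theorem theorem23 (R : realType) (n : nat) (w : 'cV[int]_n) (c : int)
    (w_gt0 : forall i, 0 < w i 0) (c_gt0 : 0 < c) (w_le_c : forall i, w i 0 <= c)
    (C : {set 'I_n}) (beta : nat) (beta_lt : (beta < #|C|)%N)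
    (valid : forall x : 'cV[R]_n, knapsack_polytope w c x ->
       \sum_(j in C) x j 0 <= beta%:R) :
  (~~ odd #|C| ->
     forall K : lifted_ineq R n,
       skils (cover_coef C) beta K <->
       exists I, scils C beta I /\ K = scale_ineq 2 I) /\
  (odd #|C| ->
     forall (i0 : 'I_n) (P : {set 'I_n * 'I_n}),
       i0 \in C -> pair_partition P (C :\ i0) ->
       exists K : lifted_ineq R n,
         [/\ unique (skils_given C beta i0 P) K,
             forall X : 'M[R]_n, unit_interval_sym X ->
               satisfies X (scils_ineq R beta (Some i0) P) -> satisfies X K
           & exists X : 'M[R]_n, [/\ unit_interval_sym X, satisfies X K
               & ~ satisfies X (scils_ineq R beta (Some i0) P)]]).
Proof.
split=> [evC K|odC i0 P i0C pP].
  have /card_gt0P[i iC] : (0 < #|C|)%N by lia.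
  have scaleE P : scale_ineq 2 (scils_ineq R beta None P) =
      LiftedIneq (2 *: \sum_(p in P) delta_mx p.1 p.2) (2 * beta./2)%:R.
    by rewrite /scale_ineq /= -natrM.
  split=> [[o [P [choP ->]]]|[_ [[o [P [pP ->]]] ->]]].
    have pC : pairing C (o C) (P C).
      by move/forallP: choP => /(_ C); rewrite (cover_class_mem iC).
    have oC : o C = None by case: (o C) pC => // j; rewrite /= (negbTE evC).
    exists (scils_ineq R beta None (P C)); split.
      by exists None, (P C); rewrite -oC.
    by rewrite scaleE (skils_ineq_cover _ _ _ _ iC) oC add0r (negbTE evC).
  have o0 : o = None by case: o pP => // j; rewrite /= (negbTE evC).
  have [o' [P' [choP oC PC]]] := skils_choice_extend pP.
  exists o', P'; split=> //.
  by rewrite o0 scaleE (skils_ineq_cover _ _ _ _ iC) oC PC o0 add0r (negbTE evC).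
pose K := LiftedIneq (delta_mx i0 i0 + 2 *: \sum_(p in P) delta_mx p.1 p.2)
  (beta%:R : R).
have satK X : satisfies X K = (X i0 i0 + 2 * \sum_(p in P) X p.1 p.2 <= beta%:R).
  by rewrite /satisfies -/(mxdot _ _) linearD linearZ /= mxdot_pairs mxdot_delta.
have givenE o Q : o C = Some i0 -> Q C = P ->
    skils_ineq R (cover_coef C) beta o Q = K.
  by move=> oC QC; rewrite (skils_ineq_cover _ _ _ _ i0C) oC QC odC.
exists K; split.
- split=> [|_ [o [Q [_ oC QC ->]]]]; last by rewrite givenE.
  have [|o [Q [choQ oC QC]]] := @skils_choice_extend _ C (Some i0) P.
    by rewrite /= odC i0C.
  by exists o, Q; split; rewrite ?givenE.
- move=> X [_ X01]; rewrite (satisfies_scils_Some _ _ _ pP) satK.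
  exact: scils_imp_skils.
have [|X [X01 leX nX]] := skils_tight_not_scils R i0 pP (beta := beta).
  rewrite (valid_cover_rhs_gt0 (w_le_c i0) i0C valid) /=.
  by move: beta_lt; rewrite (cardsD1 i0 C) i0C.
by exists X; rewrite satK.
Qed.
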